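(* Fix an integer $n\ge2$. Let $F$ be a nondegenerate law on $\mathbb R$ having a density that is symmetric about zero and nonincreasing on $[0,\infty)$. Then $$\mathbb E Z_F^{2m}\le\mathbb E Z_U^{2m}\qquad\text{for every integer } m\ge0,$$ and, for every $s,t\ge0$, $$\mathbb E e^{sZ_F^2}\le\mathbb E e^{sZ_U^2},\qquad \mathbb E\cosh(tZ_F)\le\mathbb E\cosh(tZ_U).$$ If $F$ is not uniform up to scale (i.e. not the uniform law on $[-c,c]$ for any $c>0$), the inequality $\mathbb E Z_F^{2m}\le\mathbb E Z_U^{2m}$ is strict for every $m\ge2$.
   Context: For a law $F$ on $\mathbb R$ with no atom at zero, and $X_1,\dots,X_n$ i.i.d. from $F$, write $$Z_F=\frac{X_1+\cdots+X_n}{(X_1^2+\cdots+X_n^2)^{1/2}}.$$ $Z_U$ denotes the same quantity for a centered-uniform sample, i.e. $X_i$ i.i.d. uniform on $[-1,1]$ (the scale is immaterial). *)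

(* Defs.v *)
From HB Require Import structures.
From mathcomp Require Import all_boot all_order all_algebra.
From mathcomp Require Import all_classical all_reals all_analysis.
From mathcomp Require Import measurable_realfun.

Set Implicit Arguments.
Unset Strict Implicit.
Unset Printing Implicit Defensive.

Import Order.TTheory GRing.Theory Num.Theory.
Import numFieldNormedType.Exports.

Local Open Scope classical_set_scope.
Local Open Scope ring_scope.

(** Densities are [\bar R]-valued: a density that is nonincreasing on the closed
    half-line [0, +oo[ may then be unbounded near [0], with [f 0 = +oo]. *)
Definition is_density (R : realType) (F : probability (measurableTypeR R) R)
    (f : R -> \bar R) : Prop :=
  [/\ measurable_fun setT f,
      forall x, (0 <= f x)%E &
      forall A : set (measurableTypeR R), measurable A ->
        F A = (\int[lebesgue_measure]_(x in A) f x)%E].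

Definition symmetric_about0 (R : realType) (f : R -> \bar R) : Prop :=
  forall x, f (- x) = f x.

Definition nonincreasing_on_nneg (R : realType) (f : R -> \bar R) : Prop :=
  {in `[0, +oo[ &, {homo f : x y / x <= y >-> (y <= x)%E}}.

Definition nondegenerate_law (R : realType)
    (F : probability (measurableTypeR R) R) : Prop :=
  forall c : R, F [set c] <> 1%E.

Lemma ltN_self (R : realType) (c : R) : 0 < c -> - c < c.
Proof. by move=> c0; rewrite gtrN. Qed.

(** The uniform law on [[-c, c]]. *)
Definition centered_uniform (R : realType) (c : R) (hc : 0 < c) :
    probability (measurableTypeR R) R :=
  uniform_prob (ltN_self hc).

Definition uniform_up_to_scale (R : realType)
    (F : probability (measurableTypeR R) R) : Prop :=
  exists (c : R) (hc : 0 < c), forall A : set (measurableTypeR R),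
    measurable A -> F A = centered_uniform hc A.

Definition mutually_independent (R : realType) (d : measure_display)
    (T : measurableType d) (P : probability T R) (n : nat)
    (X : 'I_n -> {RV P >-> R}) : Prop :=
  forall (J : {set 'I_n}) (A : 'I_n -> set (measurableTypeR R)),
    (forall i, measurable (A i)) ->
    P (\bigcap_(i in [set` J]) (X i @^-1` A i)) =
    (\prod_(i in J) P (X i @^-1` A i))%E.

Definition iid_sample (R : realType) (d : measure_display)
    (T : measurableType d) (P : probability T R) (n : nat)
    (X : 'I_n -> {RV P >-> R}) (F : probability (measurableTypeR R) R) : Prop :=
  mutually_independent X /\
  forall (i : 'I_n) (A : set (measurableTypeR R)), measurable A ->
    distribution P (X i) A = F A.

(** Where all the [X i] vanish, the quotient is [0 / 0 = 0]; this event is null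
    when the common law has no atom at zero. *)
Definition selfnorm (R : realType) (d : measure_display)
    (T : measurableType d) (P : probability T R) (n : nat)
    (X : 'I_n -> {RV P >-> R}) (w : T) : R :=
  (\sum_(i < n) X i w) / Num.sqrt (\sum_(i < n) X i w ^+ 2).

Definition cosh (R : realType) (x : R) : R := (expR x + expR (- x)) / 2.

(* Main.v *)
Require Import Defs.
From HB Require Import structures.
From mathcomp Require Import all_boot all_order all_algebra.
From mathcomp Require Import all_classical all_reals all_analysis.
From mathcomp Require Import measurable_realfun ring lra.

(* The map [h x = 2 F(x) - 1] is odd and sends a variable of law [F] to a uniform
   variable on [-1, 1]. Since the density is nonincreasing, [F] is concave on the
   half-line, so [h x / x] is nonincreasing there; hence for every sample [x] the
   vector of normalized squares of [x] majorizes that of [h x]. Both laws are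
   symmetric, so the expectations can be averaged over the signs of the
   coordinates first, and the average of [(+- a_1 +- ... +- a_n) ^+ (2 * m)] is
   Schur-concave in the squares [a_i ^+ 2], strictly when [m >= 2]. The functions
   [expR (s * x ^+ 2)] and [cosh (t * x)] are series in even powers with
   nonnegative coefficients.
   In case of equality the two normalized vectors agree almost surely, so
   [h (X_i) / X_i] takes the same value at two independent coordinates; it is then
   constant, [h] is almost surely linear, and [F] is uniform. *)

Set Implicit Arguments.
Unset Strict Implicit.
Unset Printing Implicit Defensive.

Import Order.TTheory GRing.Theory Num.Theory.
Import numFieldNormedType.Exports.

Local Open Scope classical_set_scope.
Local Open Scope ring_scope.

(** * Sums over signs *)

(** With [odd_partS], a coupled recurrence for twice the even and odd parts in [t] of
    [(s + t) ^+ k]; its coefficients [s] and [t] are nonnegative in the uses below, so positivity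
    and monotonicity in [t] follow by induction on [k]. *)
Lemma even_partS (R : comPzRingType) (s t : R) (k : nat) :
  (s + t) ^+ k.+1 + (s - t) ^+ k.+1 =
  s * ((s + t) ^+ k + (s - t) ^+ k) + t * ((s + t) ^+ k - (s - t) ^+ k).
Proof. by rewrite !exprS; ring. Qed.

Lemma odd_partS (R : comPzRingType) (s t : R) (k : nat) :
  (s + t) ^+ k.+1 - (s - t) ^+ k.+1 =
  s * ((s + t) ^+ k - (s - t) ^+ k) + t * ((s + t) ^+ k + (s - t) ^+ k).
Proof. by rewrite !exprS; ring. Qed.

Lemma even_odd_part_le (R : realDomainType) (s r r' : R) (k : nat) :
  0 <= s -> 0 <= r <= r' ->
  [/\ 0 <= (s + r) ^+ k + (s - r) ^+ k <= (s + r') ^+ k + (s - r') ^+ k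
    & 0 <= (s + r) ^+ k - (s - r) ^+ k <= (s + r') ^+ k - (s - r') ^+ k].
Proof.
move=> s0 /andP[r0 rr']; elim: k => [|k [/andP[A0 AA'] /andP[B0 BB']]].
  by rewrite !expr0 subrr !lexx addr_ge0.
have r'0 := le_trans r0 rr'.
set A := _ + _ in A0 AA'; set A' := (X in _ <= X) in AA'.
set B := _ - _ in B0 BB'; set B' := (X in _ <= X) in BB'.
rewrite !even_partS !odd_partS -/A -/B -/A' -/B'.
by split; apply/andP; split; rewrite ?addr_ge0 ?mulr_ge0// lerD// ler_pM.
Qed.

(** The exponents start where strictness can: the odd part vanishes at exponent 0, and the even part
    does not depend on [r] at exponents 0 and 1. *)
Lemma even_odd_part_lt (R : realDomainType) (s r r' : R) (k : nat) :
  0 < s -> 0 <= r < r' ->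
  (s + r) ^+ k.+2 + (s - r) ^+ k.+2 < (s + r') ^+ k.+2 + (s - r') ^+ k.+2
  /\ (s + r) ^+ k.+1 - (s - r) ^+ k.+1 < (s + r') ^+ k.+1 - (s - r') ^+ k.+1.
Proof.
move=> s0 /andP[r0 rr'].
have r'0 := le_lt_trans r0 rr'.
have le_k j := @even_odd_part_le R s r r' j (ltW s0).
have ltB j : (s + r) ^+ j.+1 - (s - r) ^+ j.+1 < (s + r') ^+ j.+1 - (s - r') ^+ j.+1.
  elim: j => [|j IH]; first by rewrite !expr1; lra.
  rewrite !(odd_partS _ _ j.+1) ltr_leD ?ltr_pM2l//.
  have [|/andP[? ?] _] := le_k j.+1; first by rewrite r0 ltW.
  by rewrite ler_pM// ltW.
split=> //.
have [|/andP[A0 AA'] /andP[B0 BB']] := le_k k.+1; first by rewrite r0 ltW.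
rewrite !(even_partS _ _ k.+1) ler_ltD ?ler_pM2l//.
apply: (@le_lt_trans _ _ (r' * ((s + r) ^+ k.+1 - (s - r) ^+ k.+1))).
  by rewrite ler_wpM2r// ltW.
by rewrite ltr_pM2l.
Qed.

Lemma even_part_norm (R : realDomainType) (s r : R) (k : nat) :
  (s + r) ^+ k + (s - r) ^+ k = (s + `|r|) ^+ k + (s - `|r|) ^+ k.
Proof. by case: (ger0P r) => // _; rewrite opprK addrC. Qed.

(** The four sign choices on two coordinates [x] and [y], with the signed sum [c] of all the others
    frozen. *)
Definition four_signs (R : pzRingType) (N : nat) (c x y : R) : R :=
  (c + x + y) ^+ N + (c - x + y) ^+ N + (c + x - y) ^+ N + (c - x - y) ^+ N.

Lemma four_signsE (R : comPzRingType) (N : nat) (c x y : R) :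
  four_signs N c x y = \sum_(i < N.+1) (c ^+ (N - i) *
    (((x + y) ^+ i + (- (x + y)) ^+ i) + ((x - y) ^+ i + (- (x - y)) ^+ i)))
    *+ 'C(N, i).
Proof.
have -> : four_signs N c x y = ((c + (x + y)) ^+ N + (c + - (x + y)) ^+ N)
    + ((c + (x - y)) ^+ N + (c + - (x - y)) ^+ N).
  have e1 : c + x + y = c + (x + y) by ring.
  have e2 : c - x + y = c + - (x - y) by ring.
  have e3 : c + x - y = c + (x - y) by ring.
  have e4 : c - x - y = c + - (x + y) by ring.
  rewrite /four_signs e1 e2 e3 e4 -!addrA; congr (_ + _).
  by rewrite addrCA [RHS]addrCA; congr (_ + _); exact: addrC.
rewrite !exprDn -!big_split/=; apply: eq_bigr => i _.
by rewrite -!mulrnDl -!mulrDr.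
Qed.

(** The squares of [x + y] and [x - y] are [x ^+ 2 + y ^+ 2] plus or minus [2 * (x * y)], so at a
    fixed sum of squares the terms of even degree depend on [|x * y|] alone. *)
Lemma four_signs_term (R : comPzRingType) (i : nat) (x y : R) :
  ((x + y) ^+ i + (- (x + y)) ^+ i) + ((x - y) ^+ i + (- (x - y)) ^+ i) =
  if odd i then 0 else ((x ^+ 2 + y ^+ 2 + 2 * (x * y)) ^+ i./2
    + (x ^+ 2 + y ^+ 2 - 2 * (x * y)) ^+ i./2) *+ 2.
Proof.
rewrite (exprNn (x + y)) (exprNn (x - y)) -signr_odd.
case: ifPn => oi; first by rewrite expr1 !mulN1r !subrr addr0.
rewrite expr0 !mul1r -[in LHS](odd_double_half i) (negbTE oi) add0n -mul2n !exprM.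
have -> : (x + y) ^+ 2 = x ^+ 2 + y ^+ 2 + 2 * (x * y) by ring.
have -> : (x - y) ^+ 2 = x ^+ 2 + y ^+ 2 - 2 * (x * y) by ring.
by rewrite -!mulr2n mulrnDl.
Qed.

Lemma four_signs_term_le (R : realDomainType) (m : nat) (c x y x' y' : R)
    (i : 'I_(2 * m).+1) :
  x ^+ 2 + y ^+ 2 = x' ^+ 2 + y' ^+ 2 -> `|x * y| <= `|x' * y'| ->
  c ^+ (2 * m - i) *
    (((x + y) ^+ i + (- (x + y)) ^+ i) + ((x - y) ^+ i + (- (x - y)) ^+ i)) <=
  c ^+ (2 * m - i) *
    (((x' + y') ^+ i + (- (x' + y')) ^+ i) + ((x' - y') ^+ i + (- (x' - y')) ^+ i)).
Proof.
move=> E le_xy; rewrite !four_signs_term -E.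
case: ifPn => oi; first by rewrite !mulr0.
rewrite ler_wpM2l ?lerMn2r//=.
  (* Here [i] is even, hence so is [2 * m - i], and the power of [c] is nonnegative for [c] of
     either sign. *)
  by rewrite exprn_even_ge0// oddB -1?ltnS// oddM/= (negbTE oi).
rewrite even_part_norm [leRHS]even_part_norm.
have [||/andP[_ ->]//] := @even_odd_part_le R (x ^+ 2 + y ^+ 2)
    `|2 * (x * y)| `|2 * (x' * y')| i./2; first by rewrite addr_ge0 ?sqr_ge0.
by rewrite normr_ge0/= ![ `|2 * _| ]normrM ler_pM2l ?normr_gt0 ?pnatr_eq0.
Qed.

Lemma four_signs_le (R : realDomainType) (m : nat) (c x y x' y' : R) :
  x ^+ 2 + y ^+ 2 = x' ^+ 2 + y' ^+ 2 -> `|x * y| <= `|x' * y'| ->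
  four_signs (2 * m) c x y <= four_signs (2 * m) c x' y'.
Proof.
move=> E le_xy; rewrite !four_signsE ler_sum// => i _.
by rewrite lerMn2r four_signs_term_le ?orbT.
Qed.

(* The strictness comes from the term of degree 0 in [c]. *)
Lemma four_signs_lt (R : realDomainType) (m : nat) (c x y x' y' : R) :
  (1 < m)%N ->
  x ^+ 2 + y ^+ 2 = x' ^+ 2 + y' ^+ 2 -> `|x * y| < `|x' * y'| ->
  four_signs (2 * m) c x y < four_signs (2 * m) c x' y'.
Proof.
move=> m1 E lt_xy; rewrite !four_signsE !big_ord_recr/= ler_ltD//.
  rewrite ler_sum// => i _; rewrite lerMn2r; apply/orP; right.
  exact: (four_signs_term_le c (widen_ord (leqnSn _) i) E (ltW lt_xy)).
rewrite subnn binn expr0 !mul1r !mulr1n !four_signs_term oddM/= -E ltrMn2r/=.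
rewrite even_part_norm [ltRHS]even_part_norm mul2n doubleK.
(* The half exponent is [m], so [m >= 2] is exactly the range where the even part is strictly
   increasing. *)
case: m m1 => [//|[//|m _]].
have [||->//] := @even_odd_part_lt R (x ^+ 2 + y ^+ 2) `|2 * (x * y)| `|2 * (x' * y')| m.
  (* If the sum of squares were 0, then [x'] would vanish and [|x' * y'|] could not exceed
     [|x * y|]. *)
  rewrite lt0r addr_ge0 ?sqr_ge0// andbT E paddr_eq0 ?sqr_ge0// !sqrf_eq0.
  apply/negP => /andP[/eqP x0 _]; move: lt_xy.
  by rewrite x0 mul0r normr0 ltNge normr_ge0.
by rewrite normr_ge0/= ![ `|2 * _| ]normrM ltr_pM2l ?normr_gt0 ?pnatr_eq0.
Qed.

(** The average over independent random signs, left multiplied by the number of patterns to avoid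
    division; [true] encodes a minus sign. *)
Definition sign_sum (R : pzRingType) (n : nat) (phi : R -> R) (a : 'I_n -> R) : R :=
  \sum_(e : {ffun 'I_n -> bool}) phi (\sum_(i < n) (-1) ^+ e i * a i).

Definition flip_sign (n : nat) (i : 'I_n) (e : {ffun 'I_n -> bool}) :
  {ffun 'I_n -> bool} := [ffun k => e k (+) (k == i)].

Lemma flip_signK (n : nat) (i : 'I_n) : involutive (flip_sign i).
Proof. by move=> e; apply/ffunP => k; rewrite !ffunE -addbA addbb addbF. Qed.

Lemma sign_sum_flip (R : pzRingType) (n : nat) (phi : R -> R) (a : 'I_n -> R)
    (i : 'I_n) :
  sign_sum phi a =
  \sum_(e : {ffun 'I_n -> bool}) phi (\sum_(k < n) (-1) ^+ flip_sign i e k * a k).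
Proof. by rewrite /sign_sum (reindex_inj (inv_inj (flip_signK i))). Qed.

(** Flipping the sign of [i], of [j] or of both permutes the patterns, so four copies of the sum can
    be added pattern by pattern, without choosing representatives modulo the flips. *)
Lemma sign_sum_four (R : pzRingType) (n N : nat) (a : 'I_n -> R) (i j : 'I_n) :
  i != j ->
  sign_sum (fun x => x ^+ N) a *+ 4 =
  \sum_(e : {ffun 'I_n -> bool}) four_signs N
     (\sum_(k < n | (k != i) && (k != j)) (-1) ^+ e k * a k)
     ((-1) ^+ e i * a i) ((-1) ^+ e j * a j).
Proof.
move=> ij; set S := sign_sum _ _.
have lin (e : {ffun 'I_n -> bool}) : \sum_(k < n) (-1) ^+ e k * a k =
    \sum_(k < n | (k != i) && (k != j)) (-1) ^+ e k * a k
      + (-1) ^+ e i * a i + (-1) ^+ e j * a j.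
  rewrite (bigD1 i)//= (bigD1 j)/=; last by rewrite eq_sym.
  by rewrite addrC (addrC (_ * a j)) addrAC.
have tail (e e' : {ffun 'I_n -> bool}) :
    (forall k, k != i -> k != j -> e k = e' k) ->
    \sum_(k < n | (k != i) && (k != j)) (-1) ^+ e k * a k =
    \sum_(k < n | (k != i) && (k != j)) (-1) ^+ e' k * a k.
  by move=> ee'; apply: eq_bigr => k /andP[ki kj]; rewrite ee'.
have E1 : S = \sum_(e : {ffun 'I_n -> bool})
    (\sum_(k < n) (-1) ^+ flip_sign i e k * a k) ^+ N.
  exact: (sign_sum_flip (fun x => x ^+ N)).
have E2 : S = \sum_(e : {ffun 'I_n -> bool})
    (\sum_(k < n) (-1) ^+ flip_sign j e k * a k) ^+ N.
  exact: (sign_sum_flip (fun x => x ^+ N)).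
have E3 : S = \sum_(e : {ffun 'I_n -> bool})
    (\sum_(k < n) (-1) ^+ flip_sign i (flip_sign j e) k * a k) ^+ N.
  by rewrite E1 [LHS](reindex_inj (inv_inj (flip_signK j))).
have -> : S *+ 4 = S + S + S + S by rewrite !mulrS mulr0n addr0 !addrA.
transitivity (\sum_(e : {ffun 'I_n -> bool})
   ((\sum_(k < n) (-1) ^+ e k * a k) ^+ N +
   (\sum_(k < n) (-1) ^+ flip_sign i e k * a k) ^+ N +
   (\sum_(k < n) (-1) ^+ flip_sign j e k * a k) ^+ N +
   (\sum_(k < n) (-1) ^+ flip_sign i (flip_sign j e) k * a k) ^+ N)).
  by rewrite !big_split/= -E1 -E2 -E3.
apply: eq_bigr => e _; rewrite /four_signs !lin.
rewrite (tail (flip_sign i e) e); last by move=> k ki kj; rewrite ffunE (negbTE ki) addbF.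
rewrite (tail (flip_sign j e) e); last by move=> k ki kj; rewrite ffunE (negbTE kj) addbF.
rewrite (tail (flip_sign i (flip_sign j e)) e); last first.
  by move=> k ki kj; rewrite !ffunE (negbTE kj) (negbTE ki) !addbF.
have ji : j != i by rewrite eq_sym.
rewrite !ffunE !eqxx (negbTE ij) (negbTE ji) !addbF !addbT.
by rewrite !signrN !mulNr.
Qed.

(** For each pattern the signed sum of the other coordinates is the same for [a] and [b], and plays
    the role of [c] in [four_signs]. *)
Lemma sign_sum_transfer (R : realDomainType) (n m : nat) (a b : 'I_n -> R)
    (i j : 'I_n) : i != j ->
  (forall k, k != i -> k != j -> a k = b k) ->
  a i ^+ 2 + a j ^+ 2 = b i ^+ 2 + b j ^+ 2 -> `|a i * a j| < `|b i * b j| ->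
  sign_sum (fun x => x ^+ (2 * m)) a <= sign_sum (fun x => x ^+ (2 * m)) b
  /\ ((1 < m)%N ->
     sign_sum (fun x => x ^+ (2 * m)) a < sign_sum (fun x => x ^+ (2 * m)) b).
Proof.
move=> ij ab Eab lt_ab.
have sq2 (e : bool) (x : R) : ((-1) ^+ e * x) ^+ 2 = x ^+ 2.
  by rewrite exprMn sqrr_sign mul1r.
have tail (e : {ffun 'I_n -> bool}) :
    \sum_(k < n | (k != i) && (k != j)) (-1) ^+ e k * a k =
    \sum_(k < n | (k != i) && (k != j)) (-1) ^+ e k * b k.
  by apply: eq_bigr => k /andP[ki kj]; rewrite ab.
have norm2 (e e' : bool) (x y : R) : `|(-1) ^+ e * x * ((-1) ^+ e' * y)| = `|x * y|.
  by rewrite !normrM !normrX !normrN1 !expr1n !mul1r.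
split=> [|m1].
  rewrite -(@ler_pMn2r _ 4)// !(sign_sum_four _ _ ij) ler_sum// => e _.
  by rewrite tail four_signs_le ?sq2 ?norm2 ?ltW.
rewrite -(@ltr_pMn2r _ 4)// !(sign_sum_four _ _ ij).
apply: ltr_sum => [|e _]; last by rewrite tail four_signs_lt ?sq2 ?norm2.
by apply/hasP; exists [ffun=> false]; rewrite ?mem_index_enum.
Qed.

(** * Majorization through transfers of square mass *)

(** A Robin Hood transfer of square mass from [x] to [y], stopped as soon as one of them reaches its
    target [x'] or [y']. *)
Lemma square_transfer (R : rcfType) (x y x' y' : R) :
  0 <= y' -> y' <= x' -> 0 <= y -> x' < x -> y < y' ->
  exists u v, [/\ u ^+ 2 + v ^+ 2 = x ^+ 2 + y ^+ 2,
    x' <= u, 0 <= v <= y', (u == x') || (v == y') & x * y < u * v].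
Proof.
move=> y'0 y'x' y0 x'x yy'.
have x'0 : 0 <= x' by exact: le_trans y'x'.
(* The square mass moved is the smaller of the surplus and the deficit. *)
pose D := Num.min (x ^+ 2 - x' ^+ 2) (y' ^+ 2 - y ^+ 2).
have Dx : D <= x ^+ 2 - x' ^+ 2 by rewrite ge_min lexx.
have Dy : D <= y' ^+ 2 - y ^+ 2 by rewrite ge_min lexx orbT.
have D0 : 0 < D by rewrite lt_min !subr_gt0 !ltr_sqr ?nnegrE ?x'x ?yy'// ltW ?(le_lt_trans x'0).
have x0 : 0 < x := le_lt_trans x'0 x'x.
have u2 : 0 <= x ^+ 2 - D by rewrite subr_ge0 (le_trans Dx)// lerBlDr lerDl sqr_ge0.
have v2 : 0 <= y ^+ 2 + D by rewrite addr_ge0 ?sqr_ge0// ltW.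
exists (Num.sqrt (x ^+ 2 - D)), (Num.sqrt (y ^+ 2 + D)).
have sq_le (a b : R) : 0 <= a -> 0 <= b -> (a ^+ 2 <= b ^+ 2) = (a <= b).
  by move=> a0 b0; rewrite ler_sqr.
have su : Num.sqrt (x ^+ 2 - D) ^+ 2 = x ^+ 2 - D by rewrite sqr_sqrtr.
have sv : Num.sqrt (y ^+ 2 + D) ^+ 2 = y ^+ 2 + D by rewrite sqr_sqrtr.
split; rewrite ?sqrtr_ge0//.
- by rewrite su sv addrACA addNr addr0.
- by rewrite -sq_le ?sqrtr_ge0// su; lra.
- by rewrite -sq_le ?sqrtr_ge0// sv; lra.
- have : (D == x ^+ 2 - x' ^+ 2) || (D == y' ^+ 2 - y ^+ 2).
    by rewrite /D /Order.min; case: ifP; rewrite eqxx ?orbT.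
  by case/orP => /eqP ->; rewrite ?subKr ?subrKC sqrtr_sqr ger0_norm// eqxx ?orbT.
- rewrite -ltr_sqr ?nnegrE ?mulr_ge0 ?sqrtr_ge0 ?(ltW x0)//.
  rewrite !exprMn su sv.
  (* The product of the squares grows by [D * (x ^+ 2 - y ^+ 2 - D)], positive because [x ^+ 2 - D
     >= x' ^+ 2 >= y' ^+ 2 > y ^+ 2]. *)
  have : y' ^+ 2 <= x' ^+ 2 by rewrite ler_sqr ?nnegrE.
  nra.
Qed.

(* [a ^+ 2] majorizes [b ^+ 2], in the special form where every surplus index
   dominates every deficit index: transferring from a surplus index to a deficit
   index then preserves the property and settles one more index. *)
Definition sq_dominates (R : realDomainType) (n : nat) (a b : 'I_n -> R) : Prop :=
  [/\ forall i, 0 <= a i, forall i, 0 <= b i,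
      \sum_(i < n) a i ^+ 2 = \sum_(i < n) b i ^+ 2
    & forall i j, b i < a i -> a j < b j -> b j <= b i].

(** Induction on the number of coordinates where [a] and [b] differ: a transfer from a surplus to a
    deficit settles at least one of them. For [m >= 2] the first transfer is already strict. *)
Lemma sign_sum_dominates (R : rcfType) (n m : nat) (a b : 'I_n -> R) :
  sq_dominates a b ->
  sign_sum (fun x => x ^+ (2 * m)) a <= sign_sum (fun x => x ^+ (2 * m)) b
  /\ ((1 < m)%N -> a <> b ->
     sign_sum (fun x => x ^+ (2 * m)) a < sign_sum (fun x => x ^+ (2 * m)) b).
Proof.
have [k] := ubnP #|[pred i | a i != b i]|.
elim: k a => [//|k IH] a cardk [a0 b0 Eab surplus].
have sum0 : \sum_(i < n) (a i ^+ 2 - b i ^+ 2) = 0 by rewrite sumrB Eab subrr.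
(* As the sums of squares agree, no surplus forces [a = b], and a surplus without any deficit is
   impossible. *)
have [[i bai]|nosur] := pselect (exists i, b i < a i); last first.
  suff -> : a = b by split.
  have le_ab i : a i <= b i by rewrite leNgt; apply/negP => ?; apply: nosur; exists i.
  apply/funext => i; apply/eqP; rewrite -(@eqrXn2 _ 2)//.
  have /psumr_eq0P : \sum_(i < n) (b i ^+ 2 - a i ^+ 2) = 0 by rewrite sumrB Eab subrr.
  move=> /(_ _ i isT) => H; rewrite eq_sym -subr_eq0 H// => j _.
  by rewrite subr_ge0 ler_sqr ?nnegrE.
have [[j abj]|nodef] := pselect (exists j, a j < b j); last first.
  have /psumr_eq0P := sum0.
  have le_ba l : b l <= a l by rewrite leNgt; apply/negP => ?; apply: nodef; exists l.
  move=> /(_ _ i isT) => H.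
  have : a i ^+ 2 - b i ^+ 2 = 0 by apply: H => l _; rewrite subr_ge0 ler_sqr ?nnegrE.
  by move/eqP; rewrite subr_eq0 eqrXn2// gt_eqF.
have ij : i != j by apply: contraTneq bai => ->; rewrite -leNgt ltW.
have [u [v [Euv b_u /andP[v0 v_b] uvb lt_uv]]] :=
  square_transfer (b0 j) (surplus _ _ bai abj) (a0 j) bai abj.
pose a' l := if l == i then u else if l == j then v else a l.
have a'i : a' i = u by rewrite /a' eqxx.
have a'j : a' j = v by rewrite /a' eq_sym (negbTE ij) eqxx.
have a'l l : l != i -> l != j -> a l = a' l by rewrite /a' => /negbTE-> /negbTE->.
have [||le_aa' lt_aa'] := @sign_sum_transfer R n m a a' i j ij a'l.
- by rewrite a'i a'j Euv.
- rewrite a'i a'j !ger0_norm ?mulr_ge0//; exact: le_trans (b0 i) b_u.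
have [||le_a'b _] := IH a'.
- rewrite -ltnS; apply: leq_trans cardk; rewrite ltnS; apply: proper_card.
  (* No settled coordinate is touched, and the transfer brings [i] or [j] to its target. *)
  apply/properP; split.
    apply/fintype.subsetP => l; rewrite !inE /a'.
    case: (l =P i) => [-> _|_]; first by rewrite gt_eqF.
    by case: (l =P j) => [-> _|//]; rewrite lt_eqF.
  case/orP: uvb => [/eqP ub|/eqP vb].
    by exists i; rewrite !inE ?a'i ?ub ?eqxx// gt_eqF.
  by exists j; rewrite !inE ?a'j ?vb ?eqxx// lt_eqF.
- split => //.
  + move=> l; rewrite /a'; case: ifP => _; first exact: le_trans (b0 i) b_u.
    by case: ifP.
  + rewrite -Eab (bigD1 i)//= (bigD1 j) 1?eq_sym//= a'i a'j addrA Euv.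
    rewrite [RHS](bigD1 i)//= [in RHS](bigD1 j) 1?eq_sym//= addrA; congr (_ + _).
    by apply: eq_bigr => l /andP[li lj]; rewrite a'l.
  (* The transfer creates no new surplus or deficit, so [surplus] passes to [a']. *)
  + have a'_sur l : b l < a' l -> b l < a l.
      rewrite /a'; case: (l =P i) => [-> //|_]; case: (l =P j) => [->|//].
      by rewrite ltNge v_b.
    have a'_def l : a' l < b l -> a l < b l.
      rewrite /a'; case: (l =P i) => [->|_]; first by rewrite ltNge b_u.
      by case: (l =P j) => [->|//].
    by move=> l l' /a'_sur bal /a'_def; exact: surplus.
split => [|m1 _]; first exact: le_trans le_a'b.
exact: lt_le_trans (lt_aa' m1) le_a'b.
Qed.

(** * Even power series with nonnegative coefficients *)

(** Schur-concavity of the sign average in the squares, restricted to pairs related by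
    [sq_dominates]. The class of such [phi] is stable under nonnegative multiples and convergent
    series. *)
Definition sign_sum_monotone (R : realDomainType) (n : nat) (phi : R -> R) : Prop :=
  forall a b : 'I_n -> R, sq_dominates a b -> sign_sum phi a <= sign_sum phi b.

Lemma sign_sum_monotone_even (R : rcfType) (n m : nat) :
  @sign_sum_monotone R n (fun x => x ^+ (2 * m)).
Proof. by move=> a b /(sign_sum_dominates m)[]. Qed.

Lemma sign_sum_monotoneZ (R : realDomainType) (n : nat) (c : R) (phi : R -> R) :
  0 <= c -> sign_sum_monotone n phi -> sign_sum_monotone n (fun x => c * phi x).
Proof.
move=> c0 mphi a b ab.
by rewrite /sign_sum -!mulr_sumr ler_wpM2l// mphi.
Qed.

Lemma sign_sum_monotone_series (R : realType) (n : nat) (u : nat -> R -> R)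
    (phi : R -> R) :
  (forall k, sign_sum_monotone n (u k)) ->
  (forall x, series (fun k => u k x) @ \oo --> phi x) ->
  sign_sum_monotone n phi.
Proof.
move=> mu cu a b ab.
have cvg_S (c : 'I_n -> R) : (fun N => sign_sum (fun x => series (fun k => u k x) N) c)
    @ \oo --> sign_sum phi c.
  by apply: cvg_big => [|e _]; [exact: add_continuous | exact: cu].
apply: (ler_cvg_to (cvg_S a) (cvg_S b)); apply: nearW => N.
rewrite /sign_sum /series/= exchange_big [leRHS]exchange_big/=.
by apply: ler_sum => k _; exact: mu.
Qed.

Lemma sign_sum_monotone_expR (R : realType) (n : nat) (s : R) :
  0 <= s -> sign_sum_monotone n (fun x => expR (s * x ^+ 2)).
Proof.
move=> s0; apply: (@sign_sum_monotone_series _ _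
  (fun k x => s ^+ k / k`!%:R * x ^+ (2 * k))) => [k|x].
  apply: sign_sum_monotoneZ; last exact: sign_sum_monotone_even.
  by rewrite divr_ge0 ?exprn_ge0.
have cE : series (exp_coeff (s * x ^+ 2)) @ \oo --> expR (s * x ^+ 2) :=
  is_cvg_series_exp_coeff (s * x ^+ 2).
rewrite (_ : (fun k => _) = exp_coeff (s * x ^+ 2))//; apply/funext => k.
 by rewrite /exp_coeff/= exprMn exprM mulrAC.
Qed.

(** Only even powers of [t] survive, so the coefficients are nonnegative for [t] of any sign. Odd
    terms are kept as zeros so that partial sums match those of the two exponentials. *)
Lemma sign_sum_monotone_cosh (R : realType) (n : nat) (t : R) :
  sign_sum_monotone n (fun x => cosh (t * x)).
Proof.
apply: (@sign_sum_monotone_series _ _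
  (fun k x => if odd k then 0 else t ^+ k / k`!%:R * x ^+ k)) => [k|x].
  case: (boolP (odd k)) => [_ a b _|ok]; first by rewrite /sign_sum !big1_eq.
  have kE : k = (2 * k./2)%N by rewrite mul2n even_halfK.
  apply: sign_sum_monotoneZ; last by rewrite kE; exact: sign_sum_monotone_even.
  by rewrite divr_ge0 ?exprn_even_ge0.
rewrite /cosh -mulrN.
have cE (y : R) : series (exp_coeff y) @ \oo --> expR y := is_cvg_series_exp_coeff y.
suff -> : series (fun k => if odd k then 0 else t ^+ k / k`!%:R * x ^+ k) =
    (fun N => (series (exp_coeff (t * x)) N + series (exp_coeff (t * - x)) N) / 2).
  by apply: cvgMr_tmp; exact: (cvgD (cE (t * x)) (cE (t * - x))).
apply/funext => N.
rewrite /series/= -big_split/= mulr_suml; apply: eq_bigr => k _.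
rewrite /exp_coeff/= mulrN exprNn -signr_odd; case: ifPn => ok.
  by rewrite expr1 mulN1r mulNr subrr mul0r.
by rewrite expr0 mul1r -mulr2n -[X in _ = X / _]mulr_natr mulfK// exprMn mulrAC.
Qed.

(** * Self-normalized sums *)

(** The signs of the [a i] are absorbed into the pattern by exclusive or, a bijection of
    patterns. *)
Lemma sign_sum_norm (R : realDomainType) (n : nat) (phi : R -> R) (a : 'I_n -> R) :
  sign_sum phi (fun i => `|a i|) = sign_sum phi a.
Proof.
pose s := [ffun i => a i < 0].
have sK : involutive (fun e : {ffun 'I_n -> bool} => [ffun i => e i (+) s i]).
  by move=> e; apply/ffunP => i; rewrite !ffunE -addbA addbb addbF.
rewrite /sign_sum (reindex_inj (inv_inj sK)); apply: eq_bigr => e _.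
congr phi; apply: eq_bigr => i _; rewrite !ffunE signr_addb -mulrA; congr (_ * _).
exact: mulr_sign_norm.
Qed.

(** The quotient of [selfnorm] as a function of a deterministic vector. *)
Definition self_normalized (R : rcfType) (n : nat) (x : 'I_n -> R) : R :=
  (\sum_(i < n) x i) / Num.sqrt (\sum_(i < n) x i ^+ 2).

Lemma sum_sq_ge0 (R : realDomainType) (n : nat) (x : 'I_n -> R) :
  0 <= \sum_(i < n) x i ^+ 2.
Proof. by rewrite sumr_ge0// => i _; rewrite sqr_ge0. Qed.

Lemma sum_sq_eq0 (R : realDomainType) (n : nat) (x : 'I_n -> R) :
  \sum_(i < n) x i ^+ 2 = 0 -> forall i, x i = 0.
Proof.
move=> /eqP; rewrite psumr_eq0 => [/allP x0 i|i _]; last exact: sqr_ge0.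
by apply/eqP; rewrite -sqrf_eq0; apply: x0; rewrite mem_index_enum.
Qed.

(** Absolute values make the entries nonnegative, as [sq_dominates] demands; by [sign_sum_norm] they
    do not change sign sums. *)
Definition normalized (R : rcfType) (n : nat) (x : 'I_n -> R) (i : 'I_n) : R :=
  `|x i| / Num.sqrt (\sum_(k < n) x k ^+ 2).

Lemma sum_self_normalized (R : rcfType) (n : nat) (phi : R -> R) (x : 'I_n -> R) :
  \sum_(e : {ffun 'I_n -> bool})
    phi (self_normalized (fun i => (-1) ^+ e i * x i)) =
  sign_sum phi (normalized x).
Proof.
rewrite [RHS](_ : _ = sign_sum phi
    (fun i => `|x i / Num.sqrt (\sum_(k < n) x k ^+ 2)|)); last first.
  congr sign_sum; apply/funext => i.
  by rewrite /normalized normrM normfV (ger0_norm (sqrtr_ge0 _)).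
rewrite sign_sum_norm /sign_sum; apply: eq_bigr => e _; congr phi.
rewrite /self_normalized.
have -> : \sum_(i < n) ((-1) ^+ e i * x i) ^+ 2 = \sum_(i < n) x i ^+ 2.
  by apply: eq_bigr => i _; rewrite exprMn sqrr_sign mul1r.
by rewrite mulr_suml; apply: eq_bigr => i _; rewrite mulrA.
Qed.

(* The last condition says that [h x / x] is nonincreasing on the positives. *)
Definition star_shaped (R : realDomainType) (h : R -> R) : Prop :=
  [/\ forall x, h (- x) = - h x, forall x y, x <= y -> h x <= h y,
    forall x, 0 < x -> 0 < h x
    & forall x y, 0 <= x -> x <= y -> h y * x <= h x * y].

Lemma star_shaped0 (R : realDomainType) (h : R -> R) : star_shaped h -> h 0 = 0.
Proof.
by move=> [hN _ _ _]; have := hN 0; rewrite oppr0; lra.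
Qed.

Lemma star_shaped_norm (R : realDomainType) (h : R -> R) (x : R) :
  star_shaped h -> `|h x| = h `|x|.
Proof.
move=> sh; have h0 := star_shaped0 sh; case: sh => hN _ h_gt0 _.
have [x0|x0|->] := ltrgt0P x; last by rewrite h0 normr0.
  by rewrite gtr0_norm// h_gt0.
by rewrite hN ltr0_norm// -oppr_gt0 -hN h_gt0// oppr_gt0.
Qed.

(** For nonzero [x] both vectors have squares summing to 1. With [r] and [r'] the two norms, the
    ratio of [h |x i|] to [|x i|] is below [r' / r] at a surplus index and above it at a deficit
    index; as this ratio is nonincreasing in [|x i|], the surplus index has the larger [|x i|],
    hence the larger [h |x i|]. *)
Lemma normalized_dominates (R : rcfType) (n : nat) (h : R -> R) (x : 'I_n -> R) :
  star_shaped h -> sq_dominates (normalized x) (normalized (h \o x)).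
Proof.
move=> sh; have normh y := star_shaped_norm y sh.
case: (sh) => hN h_mono h_gt0 h_star.
set r := Num.sqrt (\sum_(k < n) x k ^+ 2).
set r' := Num.sqrt (\sum_(k < n) (h \o x) k ^+ 2).
have nE i : normalized x i = `|x i| / r by [].
have n'E i : normalized (h \o x) i = h `|x i| / r' by rewrite -normh.
have h_ge0 (y : R) : 0 <= h `|y| by rewrite -normh.
have sumE (y : 'I_n -> R) : 0 < \sum_(k < n) y k ^+ 2 -> \sum_(i < n) normalized y i ^+ 2 = 1.
  move=> y0; under eq_bigr do rewrite /normalized expr_div_n sqr_sqrtr ?(ltW y0)// real_normK ?num_real//.
  by rewrite -mulr_suml mulfV// gt_eqF.
have [/eqP sx0|sx0] := boolP (\sum_(k < n) x k ^+ 2 == 0).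
  (* For [x = 0] also [h \o x = 0], and the two normalized vectors coincide. *)
  have -> : h \o x = x.
    by apply/funext => i /=; rewrite (sum_sq_eq0 sx0) star_shaped0.
  by split=> [i|i||i j]; rewrite ?ltxx// divr_ge0.
have sx_gt0 : 0 < \sum_(k < n) x k ^+ 2 by rewrite lt0r sx0 sum_sq_ge0.
have sh_gt0 : 0 < \sum_(k < n) (h \o x) k ^+ 2.
  rewrite lt0r sum_sq_ge0 andbT; apply: contra sx0 => /eqP/sum_sq_eq0 hx0.
  rewrite big1// => i _; have [->|xi0] := eqVneq (x i) 0; first by rewrite expr0n.
  have /eqP := hx0 i; rewrite -normr_eq0 normh gt_eqF// h_gt0// normr_gt0//.
have r0 : 0 < r by rewrite sqrtr_gt0.
have r'0 : 0 < r' by rewrite sqrtr_gt0.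
split=> [i|i||i j]; rewrite ?divr_ge0//; first by rewrite !sumE.
rewrite !nE !n'E => ji ij; rewrite ler_pM2r ?invr_gt0// leNgt; apply/negP => hij.
have xij : `|x i| < `|x j| by rewrite ltNge; apply: contraTN hij => /h_mono; rewrite -leNgt.
have := h_star _ _ (normr_ge0 (x i)) (ltW xij).
rewrite leNgt => /negP; apply.
have : h `|x i| / r' * (`|x j| / r) < h `|x j| / r' * (`|x i| / r).
  apply: (@le_lt_trans _ _ (`|x i| / r * (`|x j| / r))).
    by rewrite ler_wpM2r ?divr_ge0// ltW.
  rewrite mulrC ltr_pM2r// (le_lt_trans _ ji)// divr_ge0// ltW//.
by rewrite !mulf_div ltr_pM2r// invr_gt0 mulr_gt0.
Qed.

(** * Laws of independent samples *)

(** Product formula on full boxes; subfamilies are covered by taking some sides equal to [setT]. The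
    [X i] are plain functions, so that they compose with other maps without rebundling. *)
Definition iid_law (R : realType) (d : measure_display) (T : measurableType d)
    (P : probability T R) (n : nat) (X : 'I_n -> T -> R)
    (F : probability (measurableTypeR R) R) : Prop :=
  (forall i, measurable_fun setT (X i)) /\
  forall A : 'I_n -> set (measurableTypeR R), (forall i, measurable (A i)) ->
    P [set w | forall i, A i (X i w)] = (\prod_(i < n) F (A i))%E.

Lemma iid_sample_law (R : realType) (d : measure_display) (T : measurableType d)
    (P : probability T R) (n : nat) (X : 'I_n -> {RV P >-> R})
    (F : probability (measurableTypeR R) R) :
  iid_sample X F -> iid_law P (fun i => X i : T -> R) F.
Proof.
move=> [indX lawX]; split=> [i|A mA]; first exact: measurable_funP.
have := indX [set: 'I_n]%SET A mA.
rewrite [X in P X = _](_ : _ = [set w | forall i, A i (X i w)]).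
  move=> ->; rewrite big_mkcond/=; apply: eq_bigr => i _.
  by rewrite inE -(lawX i).
by apply/seteqP; split=> [w Aw i|w Aw i _]; [apply: Aw; rewrite /= inE|exact: Aw].
Qed.

(** The maps may differ between coordinates: this serves sign changes chosen per coordinate as well
    as [centered_cdf]. *)
Lemma iid_law_comp (R : realType) (d : measure_display) (T : measurableType d)
    (P : probability T R) (n : nat) (X : 'I_n -> T -> R) (g : 'I_n -> R -> R)
    (F G : probability (measurableTypeR R) R) :
  (forall i, measurable_fun setT (g i)) ->
  (forall i (A : set (measurableTypeR R)), measurable A -> F (g i @^-1` A) = G A) ->
  iid_law P X F -> iid_law P (fun i => g i \o X i) G.
Proof.
move=> mg gFG [mX lawX]; split=> [i|A mA]; first exact: measurableT_comp.
rewrite -(eq_bigr _ (fun i _ => gFG i _ (mA i))).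
apply: (lawX (fun i => g i @^-1` A i)) => i.
by have := mg i measurableT _ (mA i); rewrite setTI.
Qed.

Definition vec (T R : Type) (n : nat) (X : 'I_n -> T -> R) (w : T) : n.-tuple R :=
  [tuple X i w | i < n].

Lemma measurable_vec (R : realType) (d : measure_display) (T : measurableType d)
    (n : nat) (X : 'I_n -> T -> R) :
  (forall i, measurable_fun setT (X i)) -> measurable_fun setT (vec X).
Proof.
move=> mX; apply/measurable_fun_tnthP => i.
by rewrite (_ : _ \o _ = X i)//; apply/funext => w /=; rewrite tnth_mktuple.
Qed.

Definition boxes (R : realType) (n : nat) : set (set (n.-tuple R)) :=
  [set B | exists2 A : 'I_n -> set (measurableTypeR R), (forall i, measurable (A i)) &
     B = [set t | forall i, A i (tnth t i)]].

Lemma measurable_tupleE (R : realType) (n : nat) :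
  (@measurable _ (n.-tuple R)) = <<s @boxes R n >>.
Proof.
apply/seteqP; split.
  apply: smallest_sub; first exact: smallest_sigma_algebra.
  rewrite -bigcup_seq => _ [i _ [C mC <-]]; apply: sub_sigma_algebra.
  (* A cylinder over coordinate [i] is the box whose other sides are the whole line. *)
  exists (fun j => if j == i then C else setT); first by move=> j; case: ifP.
  rewrite setTI; apply/seteqP; split=> t /= => [Ct j|/(_ i)]; last by rewrite eqxx.
  by case: eqP => [->|].
apply: smallest_sub; first exact: sigma_algebra_measurable.
move=> _ [A mA ->].
rewrite (_ : [set t | _] = \bigcap_(i in [set: 'I_n]) ((@tnth n R)^~ i @^-1` A i)).
  apply: fin_bigcap_measurable => // i _.
  by have := @measurable_tnth _ (measurableTypeR R) n i measurableT _ (mA i); rewrite setTI.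
by apply/seteqP; split=> [t h i _|t h i]; [exact: h|exact: (h i I)].
Qed.

(** The joint law is determined by [F]: the two image measures agree on boxes, a generating family
    stable under intersection. The samples may live on different spaces. *)
Lemma iid_law_integral (R : realType) (n : nat) (F : probability (measurableTypeR R) R)
    (d : measure_display) (T : measurableType d) (P : probability T R)
    (X : 'I_n -> T -> R)
    (d' : measure_display) (T' : measurableType d') (Q : probability T' R)
    (Y : 'I_n -> T' -> R) (f : n.-tuple R -> \bar R) :
  iid_law P X F -> iid_law Q Y F ->
  measurable_fun setT f -> (forall t, 0 <= f t)%E ->
  (\int[P]_w f (vec X w) = \int[Q]_w f (vec Y w))%E.
Proof.
move=> [mX lawX] [mY lawY] mf f0.
have mvX := measurable_vec mX; have mvY := measurable_vec mY.
pose VX : {mfun T >-> n.-tuple R} := HB.pack (vec X) (isMeasurableFun.Build _ _ _ _ _ mvX).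
pose VY : {mfun T' >-> n.-tuple R} := HB.pack (vec Y) (isMeasurableFun.Build _ _ _ _ _ mvY).
rewrite -[LHS](@ge0_integral_distribution _ _ _ _ _ P VX f)//.
rewrite -[RHS](@ge0_integral_distribution _ _ _ _ _ Q VY f)//.
apply: eq_measure_integral => A mA _.
apply: (measure_unique (@boxes R n) (fun=> setT)) => //.
- exact: measurable_tupleE.
- move=> _ _ [A1 mA1 ->] [A2 mA2 ->]; exists (fun i => A1 i `&` A2 i).
    by move=> i; exact: measurableI.
  by apply/seteqP; split=> t /= => [[h1 h2] i|h]; [split|split=> i; case: (h i)].
- by move=> _; exists (fun=> setT) => //; apply/seteqP; split.
- by rewrite bigcup_const//; exists 0%N.
- move=> _ [B mB ->].
  have preE (S : Type) (Z : 'I_n -> S -> R) :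
      vec Z @^-1` [set t | forall i, B i (tnth t i)] = [set w | forall i, B i (Z i w)].
    by apply/seteqP; split=> w /= h i; have := h i; rewrite tnth_mktuple.
  transitivity (P [set w | forall i, B i (X i w)]).
    by rewrite -(preE _ X).
  by rewrite lawX// -lawY// -(preE _ Y).
- by move=> _; rewrite (le_lt_trans (probability_le1 _ _))// ltry.
Qed.

Lemma measurable_self_normalized (R : realType) (d : measure_display)
    (T : measurableType d) (n : nat) (X : 'I_n -> T -> R) :
  (forall i, measurable_fun setT (X i)) ->
  measurable_fun setT (fun w => self_normalized (fun i => X i w)).
Proof.
move=> mX; rewrite /self_normalized; apply: measurable_funM.
  exact: measurable_sum.
(* The inverse is written as a real power, legitimate as a square root is nonnegative, to use the
   measurability of powers. *)
rewrite (_ : (fun w => _) =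
    (fun w => (Num.sqrt (\sum_(i < n) X i w ^+ 2)) `^ (- 1))); last first.
  by apply/funext => w; rewrite powR_inv1 ?sqrtr_ge0.
apply: (measurableT_comp (@measurable_powR R (- 1))).
have msqrt : measurable_fun setT (@Num.sqrt R).
  by apply: continuous_measurable_fun; exact: sqrt_continuous.
apply: (measurableT_comp msqrt).
by apply: measurable_sum => i; exact: measurable_funX.
Qed.

Lemma measurable_sign_sum_normalized (R : realType) (d : measure_display)
    (T : measurableType d) (n : nat) (phi : R -> R) (X : 'I_n -> T -> R) :
  measurable_fun setT phi -> (forall i, measurable_fun setT (X i)) ->
  measurable_fun setT (fun w => sign_sum phi (normalized (fun i => X i w))).
Proof.
move=> mphi mX; under eq_fun do rewrite -sum_self_normalized.
apply: measurable_sum => e; apply: (measurableT_comp mphi).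
by apply: measurable_self_normalized => i; exact: measurable_funM.
Qed.

Definition symmetric_law (R : realType) (F : probability (measurableTypeR R) R) : Prop :=
  forall A : set (measurableTypeR R), measurable A ->
    F ((-%R : R -> R) @^-1` A) = F A.

(** By symmetry of [F], changing signs leaves the law of the sample unchanged, so all patterns
    contribute the same integral. *)
Lemma integral_sign_sum (R : realType) (d : measure_display)
    (T : measurableType d) (P : probability T R) (n : nat) (X : 'I_n -> T -> R)
    (F : probability (measurableTypeR R) R) (phi : R -> R) :
  symmetric_law F -> iid_law P X F ->
  measurable_fun setT phi -> (forall x, 0 <= phi x) ->
  (\int[P]_w (sign_sum phi (normalized (fun i => X i w)))%:E =
   (#|{ffun 'I_n -> bool}|%:R)%:E *
     \int[P]_w (phi (self_normalized (fun i => X i w)))%:E)%E.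
Proof.
move=> symF iidX mphi phi0.
under eq_integral do rewrite -sum_self_normalized -sumEFin.
have iide (e : {ffun 'I_n -> bool}) : iid_law P (fun i w => (-1) ^+ e i * X i w) F.
  apply: (iid_law_comp (g := fun i x => (-1) ^+ e i * x) _ _ iidX) => [i|i A mA].
    exact: measurable_funM.
  case: (e i); last by rewrite expr0 (_ : _ @^-1` A = A)//; apply/funext => x /=; rewrite mul1r.
  rewrite expr1 -[RHS]symF//; congr (F (_ @^-1` A)); apply/funext => x; exact: mulN1r.
have mf : measurable_fun setT
    (fun t : n.-tuple R => (phi (self_normalized (tnth t)))%:E).
  apply/measurable_EFinP; apply: (measurableT_comp mphi).
  by apply: measurable_self_normalized => i; exact: measurable_tnth.
have vecE (Y : 'I_n -> T -> R) w : tnth (vec Y w) = (fun i => Y i w).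
  by apply/funext => i; rewrite tnth_mktuple.
rewrite ge0_integral_sum//; last 2 first.
- move=> e; apply/measurable_EFinP; apply: (measurableT_comp mphi).
  by apply: measurable_self_normalized => i; apply: measurable_funM => //; case: iidX.
- by move=> e w _; rewrite lee_fin.
rewrite (eq_bigr (fun=> \int[P]_w (phi (self_normalized (fun i => X i w)))%:E)%E).
  rewrite -(sumr_const {ffun 'I_n -> bool} (1 : R)) -sumEFin ge0_sume_distrl//.
  by under [RHS] eq_bigr do rewrite mul1e.
move=> e _; have /= := iid_law_integral (iide e) iidX mf (fun t => phi0 _).
under eq_integral do rewrite vecE.
by under [in RHS]eq_integral do rewrite vecE.
Qed.

(** The sample [h \o X i] has the joint law of [U]. This couples both samples on one space, where
    they can be compared pointwise. *)
Lemma integral_sign_sum_comp (R : realType) (n : nat)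
    (F G : probability (measurableTypeR R) R) (h : R -> R)
    (d : measure_display) (T : measurableType d) (P : probability T R)
    (X : 'I_n -> T -> R)
    (d' : measure_display) (T' : measurableType d') (Q : probability T' R)
    (U : 'I_n -> T' -> R) (phi : R -> R) :
  measurable_fun setT h ->
  (forall A : set (measurableTypeR R), measurable A -> F (h @^-1` A) = G A) ->
  iid_law P X F -> iid_law Q U G ->
  measurable_fun setT phi -> (forall x, 0 <= phi x) ->
  (\int[Q]_w (sign_sum phi (normalized (fun i => U i w)))%:E =
   \int[P]_w (sign_sum phi (normalized (fun i => h (X i w))))%:E)%E.
Proof.
move=> mh FG iidX iidU mphi phi0.
have iidhX : iid_law P (fun i => h \o X i) G by apply: iid_law_comp iidX.
have mf : measurable_fun setT
    (fun t : n.-tuple R => (sign_sum phi (normalized (tnth t)))%:E).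
  apply/measurable_EFinP/measurable_sign_sum_normalized => // i.
  exact: measurable_tnth.
have vecE (S : Type) (Y : 'I_n -> S -> R) w : tnth (vec Y w) = (fun i => Y i w).
  by apply/funext => i; rewrite tnth_mktuple.
have f0 (t : n.-tuple R) : (0 <= (sign_sum phi (normalized (tnth t)))%:E)%E.
  by rewrite lee_fin sumr_ge0.
have /= := iid_law_integral iidU iidhX mf f0.
under eq_integral do rewrite vecE.
by under [in RHS]eq_integral do rewrite vecE.
Qed.

Lemma integral_sign_sum_le (R : realType) (n : nat) (h : R -> R)
    (d : measure_display) (T : measurableType d) (P : probability T R)
    (X : 'I_n -> T -> R) (phi : R -> R) :
  star_shaped h -> sign_sum_monotone n phi -> (forall x, 0 <= phi x) ->
  measurable_fun setT h -> (forall i, measurable_fun setT (X i)) ->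
  measurable_fun setT phi ->
  (\int[P]_w (sign_sum phi (normalized (fun i => X i w)))%:E <=
   \int[P]_w (sign_sum phi (normalized (fun i => h (X i w))))%:E)%E.
Proof.
move=> sh monophi phi0 mh mX mphi.
apply: ge0_le_integral => //.
- by move=> w _; rewrite lee_fin sumr_ge0.
- exact/measurable_EFinP/measurable_sign_sum_normalized.
- apply/measurable_EFinP.
  apply: (measurable_sign_sum_normalized (X := fun i => h \o X i)) => // i.
  exact: measurableT_comp.
- by move=> w _; rewrite lee_fin; apply: monophi; exact: normalized_dominates.
Qed.

(** * The centered distribution function *)

Lemma density_symmetric_law (R : realType) (F : probability (measurableTypeR R) R)
    (f : R -> \bar R) :
  is_density F f -> symmetric_about0 f -> symmetric_law F.
Proof.
move=> [mf f0 fF] symf A mA.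
have mNA : measurable ((-%R : _ -> measurableTypeR R) @^-1` A).
  by have := @oppr_measurable R setT measurableT _ mA; rewrite setTI.
transitivity (F ((-%R : _ -> measurableTypeR R) @^-1` A)) => //.
rewrite !fF//.
under eq_integral do rewrite -symf.
rewrite -ge0_integral_pushforward//=; last exact: measurable_funTS.
by apply: eq_measure_integral => B mB _; exact: lebesgue_measureN.
Qed.

Definition cdfR (R : realType) (F : probability (measurableTypeR R) R) (x : R) : R :=
  fine (F `]-oo, x]%classic).

Lemma cdfRE (R : realType) (F : probability (measurableTypeR R) R) (x : R) :
  F `]-oo, x]%classic = (cdfR F x)%:E.
Proof. by rewrite /cdfR fineK// fin_num_measure. Qed.

Lemma cdfR_ge0 (R : realType) (F : probability (measurableTypeR R) R) (x : R) :
  0 <= cdfR F x.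
Proof. exact: fine_ge0. Qed.

Lemma cdfR_le1 (R : realType) (F : probability (measurableTypeR R) R) (x : R) :
  cdfR F x <= 1.
Proof. by rewrite -lee_fin -cdfRE probability_le1. Qed.

Lemma cdfR_nondecreasing (R : realType) (F : probability (measurableTypeR R) R) :
  {homo cdfR F : x y / x <= y}.
Proof.
move=> x y xy; rewrite -lee_fin -!cdfRE le_measure ?inE//; exact: subset_itvl.
Qed.

Lemma measurable_cdfR (R : realType) (F : probability (measurableTypeR R) R) :
  measurable_fun setT (cdfR F).
Proof. exact: nondecreasing_measurable (@cdfR_nondecreasing R F). Qed.

Lemma cdfR_itv (R : realType) (F : probability (measurableTypeR R) R) (x y : R) :
  x <= y -> F `]x, y]%classic = (cdfR F y - cdfR F x)%:E.
Proof.
move=> xy; rewrite (_ : `]x, y]%classic = `]-oo, y] `\` `]-oo, x]); last first.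
  by rewrite -[RHS]setCK setCD setCitvl setUC -[LHS]setCK setCitv.
rewrite measureD//; last by rewrite -ge0_fin_numE// fin_num_measure.
by rewrite setIidr ?EFinB -?cdfRE//; exact: subset_itvl.
Qed.

Section identity_variable.
Context (R : realType) (F : probability (measurableTypeR R) R).

(** The identity as a random variable on the line under [F], through which facts about [cdf] apply
    to [cdfR]. *)
Let idR : measurableTypeR R -> R := idfun.

#[local] HB.instance Definition _ :=
  @isMeasurableFun.Build _ _ _ _ idR (@measurable_id _ _ setT).

Let cdfR_cdf : cdfR F = fine \o cdf (idR : {RV F >-> R}).
Proof. by []. Qed.

Lemma cdfR_right_continuous : right_continuous (cdfR F).
Proof.
move=> x; rewrite cdfR_cdf; apply: fine_cvg.
by rewrite fineK ?fin_num_measure//; exact: cdf_right_continuous.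
Qed.

Lemma cvg_cdfRy : cdfR F @ +oo --> (1 : R).
Proof. rewrite cdfR_cdf; exact/fine_cvg/cvg_cdfy1. Qed.

Lemma cvg_cdfRNy : cdfR F @ -oo --> (0 : R).
Proof. rewrite cdfR_cdf; exact/fine_cvg/cvg_cdfNy0. Qed.

End identity_variable.

Lemma cdfR_gt (R : realType) (F : probability (measurableTypeR R) R) (u : R) :
  u < 1 -> exists x, u < cdfR F x.
Proof.
move=> u1; have ux : \forall x \near +oo, u < cdfR F x.
  exact: (cvgr_gt _ (@cvg_cdfRy R F)).
by have [x] := filter_ex ux; exists x.
Qed.

Lemma cdfR_lt (R : realType) (F : probability (measurableTypeR R) R) (u : R) :
  0 < u -> exists x, cdfR F x < u.
Proof.
move=> u0; have ux : \forall x \near -oo, cdfR F x < u.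
  exact: (cvgr_lt _ (@cvg_cdfRNy R F)).
by have [x] := filter_ex ux; exists x.
Qed.

(** The half-lines []x, +oo[] are stable under intersection, generate the Borel sets, and exhaust
    the line along [x = - n%:R]. *)
Lemma probability_eq_cdfR (R : realType) (F G : probability (measurableTypeR R) R) :
  cdfR F =1 cdfR G ->
  forall A : set (measurableTypeR R), measurable A -> F A = G A.
Proof.
move=> FG A mA.
have := @measure_unique _ R (measurableTypeR R) (@RGenOInfty.G R)
  (fun n : nat => `](- n%:R), +oo[%classic) _ _ _ _ F G _ _ A mA.
apply => //.
- exact: RGenOInfty.measurableE.
- move=> _ _ [x ->] [y ->]; exists (Num.max x y).
  by apply/seteqP; split=> z /=; rewrite !in_itv/= !andbT gt_max => /andP.
- by move=> k; exists (- k%:R).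
- rewrite -subTset => x _; exists (Num.bound `|x|) => //=.
  by rewrite in_itv/= andbT ltrNl (le_lt_trans (ler_norm _))// normrN archi_boundP.
- move=> _ [x ->].
  have E (H : probability (measurableTypeR R) R) : H `]x, +oo[%classic = (1 - cdfR H x)%:E.
    by rewrite -setCitvl probability_setC// cdfRE.
  by transitivity (1 - cdfR F x)%:E; [exact: E|rewrite FG; exact/esym/E].
- by move=> k; rewrite (le_lt_trans (probability_le1 _ _))// ltry.
Qed.

Lemma density_no_atom (R : realType) (F : probability (measurableTypeR R) R)
    (f : R -> \bar R) (x : R) :
  is_density F f -> F [set x] = 0%E.
Proof.
move=> [mf f0 fF]; rewrite fF//; apply: null_set_integral => //.
  exact: measurable_funTS.
exact: lebesgue_measure_set1.
Qed.

(** The map [h] of the proof idea, with values in [[-1, 1]]. *)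
Definition centered_cdf (R : realType) (F : probability (measurableTypeR R) R)
  (x : R) : R := 2 * cdfR F x - 1.

Lemma cdfRN (R : realType) (F : probability (measurableTypeR R) R) (x : R) :
  symmetric_law F -> (forall y, F [set y] = 0%E) -> cdfR F (- x) = 1 - cdfR F x.
Proof.
move=> symF noatom; apply: EFin_inj; rewrite -cdfRE -symF//.
rewrite (_ : _ @^-1` _ = [set x] `|` `]x, +oo[%classic); last first.
  apply/seteqP; split=> y /=; rewrite !in_itv/= !andbT lerN2.
    by rewrite le_eqVlt => /predU1P[->|]; [left|right].
  by case=> [->|/ltW].
have -> : F ([set x] `|` `]x, +oo[%classic) = F `]x, +oo[%classic.
  rewrite measureU//; first by rewrite -[RHS]add0e; congr (_ + _)%E; exact: noatom.
  by apply/seteqP; split=> y //= [->]; rewrite in_itv/= ltxx.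
by rewrite -setCitvl probability_setC// cdfRE.
Qed.

(** The value [f x] bounds the density from below on []0, x]] and from above on []x, y]], so it
    separates the mean slopes of the distribution function on the two intervals. *)
Lemma density_concave (R : realType) (F : probability (measurableTypeR R) R)
    (f : R -> \bar R) (x y : R) :
  is_density F f -> nonincreasing_on_nneg f -> 0 < x -> x <= y ->
  (cdfR F y - cdfR F 0) * x <= (cdfR F x - cdfR F 0) * y.
Proof.
move=> [mf f0 fF] f_dec x0 xy.
have lo : (f x * x%:E <= (cdfR F x - cdfR F 0)%:E)%E.
  rewrite -cdfR_itv ?(ltW x0)// fF//.
  rewrite (_ : x%:E = lebesgue_measure `]0, x]%classic); last first.
    by rewrite lebesgue_measure_itv/= lte_fin x0 sube0.
  rewrite -integral_cst//; apply: ge0_le_integral => //; [by move=> *; exact: f0|exact: measurable_funTS|].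
  move=> z; rewrite /= in_itv/= => /andP[z0 zx].
  by apply: f_dec => //; rewrite in_itv/= andbT ltW.
have up : ((cdfR F y - cdfR F x)%:E <= f x * (y - x)%:E)%E.
  rewrite -cdfR_itv// fF//.
  rewrite (_ : (y - x)%:E = lebesgue_measure `]x, y]%classic); last first.
    rewrite lebesgue_measure_itv/= lte_fin; case: ltgtP xy => // -> _.
    by rewrite subrr.
  rewrite -integral_cst//; apply: ge0_le_integral => //; first exact: measurable_funTS.
  move=> z; rewrite /= in_itv/= => /andP[xz zy].
  by apply: f_dec; rewrite ?in_itv/= ?andbT ltW// (lt_trans x0).
(* [f x] is finite, since [x > 0] and [f x * x%:E] is at most a probability. *)
have [r fr] : exists r, f x = r%:E.
  move: lo (f0 x); case: (f x) => [r _ _|/=|//]; first by exists r.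
  by rewrite gt0_mulye ?lte_fin// leye_eq.
move: lo up; rewrite fr -!EFinM !lee_fin => lo up.
have yx : 0 <= y - x by rewrite subr_ge0.
nra.
Qed.

Lemma star_shaped_centered_cdf (R : realType)
    (F : probability (measurableTypeR R) R) (f : R -> \bar R) :
  is_density F f -> symmetric_about0 f -> nonincreasing_on_nneg f ->
  star_shaped (centered_cdf F).
Proof.
move=> fF symf f_dec.
have symF := density_symmetric_law fF symf.
have noatom y := density_no_atom y fF.
have cN x := cdfRN x symF noatom.
have c0 : cdfR F 0 = 2^-1 by have := cN 0; rewrite oppr0; lra.
have star x y : 0 <= x -> x <= y -> centered_cdf F y * x <= centered_cdf F x * y.
  rewrite le_eqVlt => /predU1P[<-|x0] xy.
    by rewrite mulr0 /centered_cdf c0 divff// subrr mul0r.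
  have := density_concave fF f_dec x0 xy; rewrite /centered_cdf c0; lra.
have mono x y : x <= y -> centered_cdf F x <= centered_cdf F y.
  by move=> /(@cdfR_nondecreasing _ F); rewrite /centered_cdf; lra.
split=> // [x|x x0]; first by rewrite /centered_cdf cN; lra.
(* If [centered_cdf F] were nonpositive at some [x > 0], [star] would keep it nonpositive beyond
   [x], although [cdfR F] exceeds one half somewhere. *)
rewrite ltNge; apply/negP => Fx0.
have [y /= y2] : exists y, 2^-1 < cdfR F y by apply: cdfR_gt; lra.
have [yx|xy] := leP y x.
  by have := @cdfR_nondecreasing _ F _ _ yx; move: Fx0; rewrite /centered_cdf; lra.
have := star _ _ (ltW x0) (ltW xy).
have y0 : 0 < y by exact: lt_trans xy.
have : 0 < centered_cdf F y * x by rewrite mulr_gt0// /centered_cdf; lra.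
have : centered_cdf F x * y <= 0 by rewrite mulr_le0_ge0 // ltW.
lra.
Qed.

(** * Quantiles and the law of the centered distribution function *)

(** [s] is the supremum of the sublevel set. Right continuity gives [u <= cdfR F s]; the other
    inequality is right continuity at [- s], read through the symmetry of [F]. *)
Lemma cdfR_quantile (R : realType) (F : probability (measurableTypeR R) R) (u : R) :
  symmetric_law F -> (forall y, F [set y] = 0%E) -> 0 < u < 1 ->
  exists2 s, cdfR F s = u & forall x, cdfR F x <= u -> x <= s.
Proof.
move=> symF noatom /andP[u0 u1].
pose S := [set x | cdfR F x <= u].
have [a au] := cdfR_lt F u0; have [b ub] := cdfR_gt F u1.
have supS : has_sup S.
  split; first by exists a; exact: ltW.
  exists b => x /= xu; rewrite leNgt; apply/negP => /ltW bx.
  by have := @cdfR_nondecreasing _ F _ _ bx; rewrite leNgt (le_lt_trans xu).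
have right_lim x v : (forall t, x < t -> v <= cdfR F t) -> v <= cdfR F x.
  move=> xv; apply: (cvgr_to_ge (@cdfR_right_continuous _ F x)).
  near=> t; apply: xv; near: t; exact: nbhs_right_gt.
have S_lt t : t < sup S -> cdfR F t <= u.
  move=> /(sup_gt (proj1 supS))[x /= xu /ltW tx].
  exact: le_trans (@cdfR_nondecreasing _ F _ _ tx) xu.
have S_gt t : sup S < t -> u < cdfR F t.
  move=> st; rewrite ltNge; apply/negP => tu; move: st.
  by rewrite ltNge (ub_le_sup (proj2 supS) tu).
exists (sup S); last by move=> x xu; rewrite (ub_le_sup (proj2 supS) xu).
apply/eqP; rewrite eq_le; apply/andP; split; last first.
  by apply: right_lim => t /S_gt/ltW.
have : 1 - u <= cdfR F (- sup S).
  apply: right_lim => t; rewrite ltrNl => /S_lt.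
  by rewrite -[t in _ -> _ <= cdfR F t]opprK [cdfR F (- - t)]cdfRN//; lra.
by rewrite cdfRN//; lra.
Unshelve. all: by end_near. Qed.

Lemma cdfR_sublevel (R : realType) (F : probability (measurableTypeR R) R) (u : R) :
  symmetric_law F -> (forall y, F [set y] = 0%E) -> 0 <= u < 1 ->
  F [set x | cdfR F x <= u] = u%:E.
Proof.
move=> symF noatom /andP[u0 u1].
have pos v : 0 < v < 1 -> F [set x | cdfR F x <= v] = v%:E.
  move=> v01; have [s sv v_s] := cdfR_quantile symF noatom v01.
  rewrite (_ : [set x | _] = `]-oo, s]%classic) ?cdfRE ?sv//.
  apply/seteqP; split=> x /=; rewrite in_itv/=; first exact: v_s.
  by move=> /(@cdfR_nondecreasing _ F); rewrite sv.
move: u0; rewrite le_eqVlt => /predU1P[<-|u0]; last by rewrite pos ?u0.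
have msub v : measurable ([set x | cdfR F x <= v] : set (measurableTypeR R)).
  rewrite (_ : [set x | _] = cdfR F @^-1` `]-oo, v]).
    by have := @measurable_cdfR _ F measurableT `]-oo, v]%classic (measurable_itv _); rewrite setTI.
  by apply/seteqP; split=> x /=; rewrite in_itv.
(* Level 0 may have no quantile, so it is bounded by small positive levels [v]. *)
apply/eqP; rewrite eq_le measure_ge0 andbT; apply/lee_addgt0Pr => e e0.
pose v := Num.min e 2^-1.
have v0 : 0 < v < 1 by rewrite lt_min e0 gt_min invr_gt0 ltr0n/= orbC invf_lt1// ltr1n.
apply: (@le_trans _ _ (F [set x | cdfR F x <= v])).
  by apply: le_measure; rewrite ?inE// => x /= /le_trans; apply; case/andP: v0 => /ltW.
by rewrite pos// add0e lee_fin ge_min lexx.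
Qed.

Lemma cdfR_uniform (R : realType) (c v : R) (hc : 0 < c) :
  cdfR (centered_uniform hc) v = (Num.max (- c) (Num.min v c) + c) / (2 * c).
Proof.
apply: EFin_inj; rewrite -cdfRE.
transitivity (\int[lebesgue_measure]_(x in `]-oo, v]) (uniform_pdf (- c) c x)%:E)%E => //.
rewrite integral_uniform_pdf.
rewrite (_ : _ `&` _ = `[- c, Num.min v c]%classic); last first.
  apply/seteqP; split=> x /=; rewrite !in_itv/= le_min; last by move=> /and3P[-> -> ->].
  by case=> -> /andP[-> ->].
rewrite (eq_integral (fun=> (2 * c)^-1%:E)); last first.
  move=> x; rewrite inE/= in_itv/= le_min => /and3P[cx _ xc].
  by rewrite /uniform_pdf cx xc opprK mulr2n mulrDl mul1r.
rewrite integral_cst//= lebesgue_measure_itv/= lte_fin.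
case: ltP => [cv|vc]; last first.
  by rewrite mule0 addNr mul0r.
by rewrite -EFinD -EFinM opprK mulrC.
Qed.

Lemma measurable_centered_cdf (R : realType) (F : probability (measurableTypeR R) R) :
  measurable_fun setT (centered_cdf F).
Proof.
apply: measurable_funB => //; apply: measurable_funM => //; exact: measurable_cdfR.
Qed.

(** Probability integral transform: the event [centered_cdf F x <= v] is [cdfR F x <= (v + 1) / 2],
    of probability [(v + 1) / 2] for [v] in [[-1, 1[], and 0 or 1 outside. *)
Lemma centered_cdf_uniform (R : realType) (F : probability (measurableTypeR R) R) :
  symmetric_law F -> (forall y, F [set y] = 0%E) ->
  forall A : set (measurableTypeR R), measurable A ->
    F (centered_cdf F @^-1` A) = centered_uniform ltr01 A.
Proof.
move=> symF noatom A mA.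
pose h : measurableTypeR R -> measurableTypeR R := centered_cdf F.
have mh : measurable_fun setT h by exact: measurable_centered_cdf.
pose H : {mfun _ >-> _} := HB.pack h (isMeasurableFun.Build _ _ _ _ _ mh).
apply: (@probability_eq_cdfR R (distribution F H) (centered_uniform ltr01)) => // v.
rewrite cdfR_uniform mulr1.
have -> : cdfR (distribution F H) v = fine (F [set x | cdfR F x <= (v + 1) / 2]).
  congr (fine (F _)); apply/seteqP; split=> x /=; rewrite in_itv/= /h /centered_cdf; lra.
have [v1|v1] := ltP v (- 1).
  rewrite (_ : [set x | _] = set0) ?measure0/=.
    rewrite min_l ?max_l; lra.
  by apply/seteqP; split=> x //=; have := cdfR_ge0 F x; lra.
have [v2|v2] := ltP v 1.
  rewrite cdfR_sublevel//=; last by apply/andP; split; lra.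
  by rewrite max_r.
rewrite (_ : [set x | _] = setT).
  by rewrite probability_setT/= max_r; lra.
by apply/seteqP; split=> x //= _; have := cdfR_le1 F x; lra.
Qed.

(** * Pairs of coordinates and zero-one laws *)

Lemma iid_law_pair (R : realType) (d : measure_display) (T : measurableType d)
    (P : probability T R) (n : nat) (X : 'I_n -> T -> R)
    (F : probability (measurableTypeR R) R) (i j : 'I_n)
    (A B : set (measurableTypeR R)) :
  iid_law P X F -> i != j -> measurable A -> measurable B ->
  P (X i @^-1` A `&` X j @^-1` B) = (F A * F B)%E.
Proof.
move=> [_ lawX] ij mA mB.
pose C k : set (measurableTypeR R) := if k == i then A else if k == j then B else setT.
have mC k : measurable (C k) by rewrite /C; do 2 case: ifP => // _.
have Ci : C i = A by rewrite /C eqxx.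
have Cj : C j = B by rewrite /C eq_sym (negbTE ij) eqxx.
rewrite (_ : _ `&` _ = [set w | forall k, C k (X k w)]).
  rewrite lawX// (bigD1 i)//= (bigD1 j) 1?eq_sym//= Ci Cj big1 ?mule1// => k.
  by move=> /andP[/negbTE ki /negbTE kj]; rewrite /C ki kj probability_setT.
apply/seteqP; split=> [w [Aw Bw] k|w Cw].
  by rewrite /C; case: (k =P i) => [->//|_]; case: (k =P j) => [->|].
by split; [rewrite -Ci|rewrite -Cj]; exact: Cw.
Qed.

Lemma iid_law_marginal (R : realType) (d : measure_display) (T : measurableType d)
    (P : probability T R) (n : nat) (X : 'I_n -> T -> R)
    (F : probability (measurableTypeR R) R) (i j : 'I_n)
    (A : set (measurableTypeR R)) :
  iid_law P X F -> i != j -> measurable A -> P (X i @^-1` A) = F A.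
Proof.
move=> iidX ij mA; have := iid_law_pair iidX ij mA measurableT.
by rewrite preimage_setT setIT probability_setT mule1.
Qed.

(** Such a distribution function jumps once, at the supremum of its zero set. *)
Lemma probability_zero_one_dirac (R : realType) (G : probability (measurableTypeR R) R) :
  (forall t, cdfR G t = 0 \/ cdfR G t = 1) -> exists s, G [set s] = 1%E.
Proof.
move=> G01.
pose S := [set x | cdfR G x = 0].
have [a a1] := cdfR_lt G (@ltr01 R); have [b b0] := cdfR_gt G (@ltr01 R).
have supS : has_sup S.
  split; first by exists a; case: (G01 a) => // a1'; move: a1; rewrite a1' ltxx.
  exists b => x /= x0; rewrite leNgt; apply/negP => /ltW bx.
  by have := @cdfR_nondecreasing _ G _ _ bx; rewrite leNgt x0 b0.
exists (sup S).
pose D : probability (measurableTypeR R) R := \d_(sup S : measurableTypeR R).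
rewrite (@probability_eq_cdfR R G D)//.
  by rewrite -[D _]/(\d_(sup S) _) diracE mem_set.
move=> v; rewrite [RHS]/cdfR -[D _]/(\d_(sup S) _) diracE mem_setE in_itv/=.
have [vS|Sv] := ltP v (sup S).
  have [x /= x0 /ltW vx] := sup_gt (proj1 supS) vS.
  apply/eqP; rewrite eq_le/= mulr0n cdfR_ge0 andbT -x0; exact: cdfR_nondecreasing.
apply/eqP; rewrite eq_le/= mulr1n cdfR_le1/=.
apply: le_trans (@cdfR_nondecreasing _ G _ _ Sv).
apply: (cvgr_to_ge (@cdfR_right_continuous _ G (sup S))).
near=> t; have [t0|->//] := G01 t.
have : sup S < t by near: t; exact: nbhs_right_gt.
by rewrite ltNge (ub_le_sup (proj2 supS) t0).
Unshelve. all: by end_near. Qed.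

(** * The case of equality *)

Lemma probability_setI1 (R : realType) (d : measure_display) (T : measurableType d)
    (P : probability T R) (A B : set T) :
  measurable A -> measurable B -> P B = 1%E -> P (A `&` B) = P A.
Proof.
move=> mA mB PB1; rewrite [RHS](measureDI _ mA mB).
rewrite -[LHS]add0e; congr (_ + _)%E; apply/esym.
apply: (@subset_measure0 _ _ _ P _ (~` B)) => //.
- exact: measurableD.
- exact: measurableC.
- transitivity (1 - P B)%E; first exact: probability_setC.
  by rewrite PB1 subee.
Qed.

(** With [p] the probability of [g (X i) <= t], almost sure equality and independence give
    [p = p * p]; so the law of [g] under [F] is a Dirac mass. *)
Lemma iid_ae_eq_const (R : realType) (d : measure_display) (T : measurableType d)
    (P : probability T R) (n : nat) (X : 'I_n -> T -> R)
    (F : probability (measurableTypeR R) R) (i j : 'I_n) (g : R -> R) :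
  iid_law P X F -> i != j -> measurable_fun setT g ->
  (\forall w \ae P, g (X i w) = g (X j w)) ->
  exists s, F [set x | g x = s] = 1%E.
Proof.
move=> iidX ij mg gij; have mX := proj1 iidX.
pose h : measurableTypeR R -> measurableTypeR R := g.
have mh : measurable_fun setT h by exact: mg.
pose H : {mfun _ >-> _} := HB.pack h (isMeasurableFun.Build _ _ _ _ _ mh).
suff /probability_zero_one_dirac[s Hs] : forall t, cdfR (distribution F H) t = 0
    \/ cdfR (distribution F H) t = 1 by exists s.
move=> t; set p := cdfR _ t.
pose B : set (measurableTypeR R) := g @^-1` `]-oo, t]%classic.
have mB : measurable B.
  by have := mh measurableT `]-oo, t]%classic (measurable_itv _); rewrite setTI.
have FB : F B = p%:E by rewrite -cdfRE.
have mXB k : measurable (X k @^-1` B).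
  by have := mX k measurableT _ mB; rewrite setTI.
have : P (X i @^-1` B) = P (X i @^-1` B `&` X j @^-1` B).
  rewrite [LHS](measureDI _ (mXB i) (mXB j)) [X in (X + _)%E](_ : _ = 0%E) ?add0e//.
  apply: measure_negligible; first exact: measurableD.
  by apply: negligibleS gij => w [Bi Bj] /= gE; apply: Bj; rewrite /B/= -gE.
rewrite (iid_law_marginal iidX ij mB) (iid_law_pair iidX ij mB mB) FB -EFinM.
move=> [] /eqP; rewrite -subr_eq0 -{1}[p]mulr1 -mulrBr mulf_eq0 subr_eq0.
by case/orP => /eqP; [left|right].
Qed.

(** On a set of full measure [centered_cdf F x = s * x]; as [centered_cdf F] has the uniform law on
    [[-1, 1]], [F] is uniform on [[- s^-1, s^-1]]. *)
Lemma uniform_of_ratio (R : realType) (F : probability (measurableTypeR R) R) (s : R) :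
  symmetric_law F -> (forall y, F [set y] = 0%E) -> star_shaped (centered_cdf F) ->
  measurable [set x : measurableTypeR R | `|centered_cdf F x| / `|x| = s] ->
  F [set x | `|centered_cdf F x| / `|x| = s] = 1%E ->
  uniform_up_to_scale F.
Proof.
move=> symF noatom sh; set B := [set x | _] => mB FB.
have normh x := star_shaped_norm x sh; have h0 := star_shaped0 sh.
case: (sh) => hN _ h_gt0 _.
have s0 : 0 < s.
  rewrite ltNge; apply/negP => s_le0.
  (* A nonpositive ratio is only possible at 0, where the quotient is [0 / 0 = 0], and 0 is not an
     atom. *)
  have : F B = 0%E.
    apply: (@subset_measure0 _ _ _ F _ [set 0]) => //; last exact: noatom.
    move=> x /= xs.
    apply/eqP; rewrite -[_ == _]negbK; apply/negP => x0.
    by move: s_le0; rewrite -xs leNgt normh divr_gt0 ?h_gt0 ?normr_gt0.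
  by rewrite FB => /eqP; rewrite onee_eq0.
have BE x : B x -> centered_cdf F x = s * x.
  rewrite /B/= => xs; have [x0|x0|->] := ltrgt0P x; last by rewrite h0 mulr0.
    by move: xs; rewrite normh gtr0_norm// => <-; rewrite divfK// gt_eqF.
  move: xs; rewrite normh ltr0_norm// hN => <-; rewrite divrNN divfK// lt_eqF//.
have si0 : 0 < s^-1 by rewrite invr_gt0.
exists s^-1, si0; apply: probability_eq_cdfR => v.
have E : cdfR F v = cdfR (centered_uniform (@ltr01 R)) (s * v).
  rewrite /cdfR -(centered_cdf_uniform symF noatom)//; congr fine.
  have mh : measurable (centered_cdf F @^-1` `]-oo, s * v]%classic : set (measurableTypeR R)).
    by have := @measurable_centered_cdf R F measurableT `]-oo, s * v]%classic (measurable_itv _); rewrite setTI.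
  (* Intersecting with [B] costs no mass, and on [B] the events [x <= v] and
     [centered_cdf F x <= s * v] coincide. *)
  rewrite -(probability_setI1 _ mB FB)// -[RHS](probability_setI1 mh mB FB).
  congr (F _); apply/seteqP; split=> x /=; rewrite !in_itv/= => -[xv Bx].
    by split=> //; rewrite BE// ler_pM2l.
  by split=> //; move: xv; rewrite BE// ler_pM2l.
rewrite E !cdfR_uniform.
have -> : Num.max (- 1) (Num.min (s * v) 1) = s * Num.max (- s^-1) (Num.min v s^-1).
  by rewrite maxr_pMr ?ltW// minr_pMr ?ltW// mulrN mulfV// gt_eqF.
field; rewrite gt_eqF//.
Qed.

Lemma normalized_le1 (R : rcfType) (n : nat) (x : 'I_n -> R) (i : 'I_n) :
  normalized x i <= 1.
Proof.
rewrite /normalized; set r := Num.sqrt _.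
have xr : `|x i| <= r.
  rewrite -sqrtr_sqr ler_wsqrtr// (bigD1 i)//= lerDl sumr_ge0// => k _.
  exact: sqr_ge0.
have [r0|r0] := eqVneq r 0; first by rewrite r0 invr0 mulr0.
by rewrite ler_pdivrMr ?mul1r// lt0r r0 sqrtr_ge0.
Qed.

(** A crude uniform bound, from which the integral of the sign sum is finite. *)
Lemma sign_sum_normalized_le (R : rcfType) (n m : nat) (x : 'I_n -> R) :
  sign_sum (fun y => y ^+ (2 * m)) (normalized x) <=
  n%:R ^+ (2 * m) *+ #|{ffun 'I_n -> bool}|.
Proof.
rewrite /sign_sum -sumr_const; apply: ler_sum => e _.
rewrite exprM [leRHS]exprM lerXn2r ?nnegrE ?exprn_even_ge0//.
rewrite -real_normK ?num_real// ler_sqr ?nnegrE//.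
apply: le_trans (ler_norm_sum _ _ _) _.
apply: (@le_trans _ _ (\sum_(i < n) 1)); last by rewrite sumr_const card_ord.
apply: ler_sum => i _; rewrite normrM normrX normrN1 expr1n mul1r ger0_norm.
  exact: normalized_le1.
by rewrite divr_ge0 ?sqrtr_ge0.
Qed.

(** At any coordinate with [x k != 0] the ratio is the quotient of the two norms, which does not
    depend on [k]. *)
Lemma normalized_eq_ratio (R : rcfType) (n : nat) (h : R -> R) (x : 'I_n -> R)
    (i j : 'I_n) :
  star_shaped h -> normalized x = normalized (h \o x) -> x i != 0 -> x j != 0 ->
  `|h (x i)| / `|x i| = `|h (x j)| / `|x j|.
Proof.
move=> sh eq_n xi0 xj0; case: (sh) => _ _ h_gt0 _.
have norm_neq0 (y : 'I_n -> R) : y i != 0 -> Num.sqrt (\sum_(k < n) y k ^+ 2) != 0.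
  move=> yi0; rewrite sqrtr_eq0 -ltNge lt0r sum_sq_ge0 andbT.
  by apply: contra yi0 => /eqP/sum_sq_eq0 ->.
have hx0 : h (x i) != 0.
  by rewrite -normr_eq0 star_shaped_norm// gt_eqF// h_gt0// normr_gt0.
have r0 := norm_neq0 _ xi0; have r'0 := norm_neq0 (h \o x) hx0.
have ratio k : x k != 0 -> `|h (x k)| / `|x k| =
    Num.sqrt (\sum_(k < n) (h \o x) k ^+ 2) / Num.sqrt (\sum_(k < n) x k ^+ 2).
  move=> xk0; have := congr1 (fun f => f k) eq_n; rewrite /normalized/=.
  move/eqP; rewrite eqr_div// => /eqP E.
  by apply/eqP; rewrite eqr_div ?normr_eq0// -E mulrC.
by rewrite !ratio.
Qed.

Lemma integral_sign_sum_lt (R : realType) (n m : nat)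
    (d : measure_display) (T : measurableType d) (P : probability T R)
    (X : 'I_n -> T -> R) (F : probability (measurableTypeR R) R) (i j : 'I_n) :
  i != j -> (1 < m)%N ->
  symmetric_law F -> (forall y, F [set y] = 0%E) -> star_shaped (centered_cdf F) ->
  ~ uniform_up_to_scale F -> iid_law P X F ->
  (\int[P]_w (sign_sum (fun x => x ^+ (2 * m)) (normalized (fun k => X k w)))%:E <
   \int[P]_w (sign_sum (fun x => x ^+ (2 * m))
     (normalized (fun k => centered_cdf F (X k w))))%:E)%E.
Proof.
move=> ij m1 symF noatom sh nunif iidX; have mX := proj1 iidX.
pose h := centered_cdf F; pose phi (x : R) := x ^+ (2 * m).
have mh : measurable_fun setT h by exact: measurable_centered_cdf.
have mphi : measurable_fun setT phi by exact: exprn_measurable.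
have phi0 x : 0 <= phi x by rewrite exprn_even_ge0// oddM.
pose f w := sign_sum phi (normalized (fun k => X k w)).
pose g w := sign_sum phi (normalized (fun k => h (X k w))).
have mf : measurable_fun setT f by exact: measurable_sign_sum_normalized.
have mg : measurable_fun setT g.
  apply: (measurable_sign_sum_normalized (X := fun k => h \o X k)) => // k.
  exact: measurableT_comp.
have f0 w : 0 <= f w by rewrite sumr_ge0.
have fg w : f w <= g w.
  by have [] := sign_sum_dominates m (normalized_dominates (fun k => X k w) sh).
rewrite -/phi lt_neqAle; apply/andP; split; last first.
  exact: integral_sign_sum_le (@sign_sum_monotone_even R n m) phi0 mh mX mphi.
apply/negP => /eqP Efg; apply: nunif.
(* Finiteness allows subtracting the two integrals, assumed equal. *)
have fin_f : (\int[P]_w (f w)%:E)%E \is a fin_num.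
  rewrite ge0_fin_numE; last by apply: integral_ge0 => w _; rewrite lee_fin.
  apply: (@le_lt_trans _ _ (\int[P]_w (cst (n%:R ^+ (2 * m) *+ #|{ffun 'I_n -> bool}|)%:E w)))%E.
    apply: ge0_le_integral => //.
    - by move=> w _; rewrite lee_fin.
    - exact/measurable_EFinP.
    - by move=> w _; rewrite lee_fin sign_sum_normalized_le.
  rewrite integral_cst// [X in (_ * X)%E](_ : _ = 1%E) ?mule1 ?ltry//.
  exact: probability_setT.
(* The nonnegative difference [g - f] has integral 0, hence vanishes almost everywhere. *)
have D0 : (\int[P]_w `|(g w - f w)%:E| = 0)%E.
  have E : (\int[P]_w (g w)%:E = \int[P]_w (f w)%:E + \int[P]_w (g w - f w)%:E)%E.
    rewrite -ge0_integralD//.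
    - by apply: eq_integral => w _; rewrite -EFinD subrKC.
    - by move=> w _; rewrite lee_fin.
    - exact/measurable_EFinP.
    - by move=> w _; rewrite lee_fin subr_ge0.
    - exact/measurable_EFinP/measurable_funB.
  transitivity (\int[P]_w (g w - f w)%:E)%E.
    by apply: eq_integral => w _; rewrite gee0_abs// lee_fin subr_ge0.
  have E' : (\int[P]_w (f w)%:E = \int[P]_w (f w)%:E + \int[P]_w (g w - f w)%:E)%E.
    by rewrite -E; exact: Efg.
  have := congr1 (fun z => z - \int[P]_w (f w)%:E)%E E'.
  by rewrite subee// [X in (X - _)%E]addeC addeK// => <-.
have mD : measurable_fun setT (fun w => (g w - f w)%:E).
  exact/measurable_EFinP/measurable_funB.
have /(ae_eq_integral_abs _ measurableT mD) ae0 := D0.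
have neq0 k l : k != l -> \forall w \ae P, X k w != 0.
  move=> kl; apply: (@negligibleS _ _ _ P (X k @^-1` [set 0])).
    by move=> w /= /negP; rewrite negbK => /eqP.
  apply/negligibleP.
    by have := mX k measurableT _ (measurable_set1 0); rewrite setTI.
  transitivity (F [set 0]); last exact: noatom.
  exact: (iid_law_marginal iidX kl).
have mB : measurable_fun setT (fun x : R => `|h x| / `|x|).
  rewrite (_ : (fun x => _) = (fun x => `|h x| * (`|x| `^ (- 1)))).
    apply: measurable_funM; first exact: measurableT_comp.
    apply: (measurableT_comp (@measurable_powR R (- 1))).
    exact: normr_measurable.
  by apply/funext => x; rewrite powR_inv1.
have [|s Fs] := iid_ae_eq_const iidX ij mB.
  have ji : j != i by rewrite eq_sym.
  near=> w.
  have xi0 : X i w != 0 by near: w; exact: neq0 ij.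
  have xj0 : X j w != 0 by near: w; exact: neq0 ji.
  have fgw : (g w - f w)%:E = 0%E by near: w; apply: filterS ae0 => w; exact.
  apply: (normalized_eq_ratio (x := fun k => X k w)) => //.
  (* Different normalized vectors would give [f w < g w], by the strict comparison for [m >= 2]. *)
  apply: contrapT => neq.
  have [_ /(_ m1 neq)] := sign_sum_dominates m (normalized_dominates (fun k => X k w) sh).
  by rewrite -subr_gt0; case: fgw => ->; rewrite ltxx.
apply: (uniform_of_ratio symF noatom sh _ Fs).
have := mB measurableT [set s] (measurable_set1 s).
by rewrite setTI.
Unshelve. all: by end_near. Qed.

(** * Comparison of the self-normalized expectations *)

Theorem corollary4p2 (R : realType) (n : nat) (hn : (2 <= n)%N)
    (F : probability (measurableTypeR R) R)
    (hF : nondegenerate_law F)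
    (hdens : exists f : R -> \bar R,
      [/\ is_density F f, symmetric_about0 f & nonincreasing_on_nneg f])
    (d : measure_display) (T : measurableType d) (P : probability T R)
    (X : 'I_n -> {RV P >-> R}) (hX : iid_sample X F)
    (d' : measure_display) (T' : measurableType d') (Q : probability T' R)
    (U : 'I_n -> {RV Q >-> R}) (hU : iid_sample U (centered_uniform ltr01)) :
  [/\ forall m : nat,
        ('E_P[(fun w => (selfnorm X w ^+ (2 * m))%R)]
         <= 'E_Q[(fun w => (selfnorm U w ^+ (2 * m))%R)])%E,
      forall s : R, 0 <= s ->
        ('E_P[(fun w => (expR (s * selfnorm X w ^+ 2))%R)]
         <= 'E_Q[(fun w => (expR (s * selfnorm U w ^+ 2))%R)])%E,
      forall t : R, 0 <= t ->
        ('E_P[(fun w => (cosh (t * selfnorm X w))%R)]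
         <= 'E_Q[(fun w => (cosh (t * selfnorm U w))%R)])%E
    & ~ uniform_up_to_scale F ->
      forall m : nat, (2 <= m)%N ->
        ('E_P[(fun w => (selfnorm X w ^+ (2 * m))%R)]
         < 'E_Q[(fun w => (selfnorm U w ^+ (2 * m))%R)])%E].
Proof.
move: hdens => [f [fF symf f_dec]].
have symF := density_symmetric_law fF symf.
have noatom y := density_no_atom y fF.
have sh := star_shaped_centered_cdf fF symf f_dec.
have mh := measurable_centered_cdf F.
have hF' := centered_cdf_uniform symF noatom.
have iidX := iid_sample_law hX; have iidU := iid_sample_law hU.
have mX := proj1 iidX.
(* The uniform law is the image of the symmetric law [F] under the odd map [centered_cdf F]. *)
have symU : symmetric_law (centered_uniform (@ltr01 R)).
  move=> A mA; have mNA : measurable ((-%R : R -> R) @^-1` A : set (measurableTypeR R)).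
    by have := @oppr_measurable R setT measurableT _ mA; rewrite setTI.
  have mhA : measurable (centered_cdf F @^-1` A : set (measurableTypeR R)).
    by have := mh measurableT _ mA; rewrite setTI.
  rewrite -!hF'// -[RHS]symF//; congr (F _); apply/seteqP.
  by case: sh => hN _ _ _; split=> x /=; rewrite hN.
have N0 : (0 < (#|{ffun 'I_n -> bool}|%:R : R)%:E)%E.
  by rewrite lte_fin ltr0n; apply/card_gt0P; exists [ffun=> false].
(* Multiplied by the number of sign patterns, both expectations become integrals over the same space
   [P]. *)
have EX (phi : R -> R) : measurable_fun setT phi -> (forall x : R, 0 <= phi x) ->
    ((#|{ffun 'I_n -> bool}|%:R)%:E * 'E_P[(fun w => phi (selfnorm X w))] =
     \int[P]_w (sign_sum phi (normalized (fun i => X i w)))%:E)%E.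
  move=> mphi phi0; rewrite (integral_sign_sum symF iidX mphi phi0).
  by congr (_ * _)%E; rewrite unlock.
have EU (phi : R -> R) : measurable_fun setT phi -> (forall x : R, 0 <= phi x) ->
    ((#|{ffun 'I_n -> bool}|%:R)%:E * 'E_Q[(fun w => phi (selfnorm U w))] =
     \int[P]_w (sign_sum phi (normalized (fun i => centered_cdf F (X i w))))%:E)%E.
  move=> mphi phi0; rewrite -(integral_sign_sum_comp mh hF' iidX iidU)//.
  rewrite (integral_sign_sum symU iidU mphi phi0).
  by congr (_ * _)%E; rewrite unlock.
have main (phi : R -> R) : measurable_fun setT phi -> (forall x : R, 0 <= phi x) ->
    sign_sum_monotone n phi ->
    ('E_P[(fun w => phi (selfnorm X w))] <= 'E_Q[(fun w => phi (selfnorm U w))])%E.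
  move=> mphi phi0 monophi; rewrite -(@lee_pmul2l _ (#|{ffun 'I_n -> bool}|%:R)%:E)//.
  rewrite EX// EU//; exact: integral_sign_sum_le.
have even_ge0 (m : nat) (x : R) : 0 <= x ^+ (2 * m) by rewrite exprn_even_ge0// oddM.
have mexpR (c : R) : measurable_fun setT (fun x : R => expR (c * x)).
  by apply: measurableT_comp => //; exact: measurable_funM.
split=> [m|s s0|t t0|nunif m m2].
- apply: (main (fun x => x ^+ (2 * m))) => //.
  exact: sign_sum_monotone_even.
- apply: (main (fun x => expR (s * x ^+ 2))) => [|x|].
  + exact: (measurableT_comp (mexpR s) (exprn_measurable 2)).
  + exact: expR_ge0.
  + exact: sign_sum_monotone_expR.
- apply: (main (fun x => cosh (t * x))) => [|x|].
  + rewrite /cosh; apply: measurable_funM => //; apply: measurable_funD; first exact: mexpR.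
    by under eq_fun do rewrite -mulNr; exact: mexpR.
  + by rewrite /cosh divr_ge0// addr_ge0 ?expR_ge0.
  + exact: sign_sum_monotone_cosh.
- rewrite -(@lte_pmul2l _ (#|{ffun 'I_n -> bool}|%:R)%:E)//.
  rewrite (EX (fun x => x ^+ (2 * m)))//.
  rewrite (EU (fun x => x ^+ (2 * m)))//.
  (* Two distinct coordinates, 0 and 1, exist as [n >= 2]. *)
  have i01 : Ordinal (ltnW hn) != Ordinal hn by [].
  exact: (integral_sign_sum_lt i01).
Qed.
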